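(* Let $\mathcal X$ be a real normed linear space, $\mathcal Y$ a real Banach space, and $r,s,t$ positive integers. Let $d>0$, $\varepsilon>0$, and let $f:\mathcal X\to\mathcal Y$ be a mapping with $f(0)=0$ such that $$\left\|r f\!\left(\frac{sx+ty}{r}\right)-s f(x)-t f(y)\right\|\le\varepsilon$$ for all $x,y\in\mathcal X$ with $\|x\|+\|y\|\ge d$. Then there exists a unique additive mapping $T:\mathcal X\to\mathcal Y$ such that $$\|f(x)-T(x)\|\le\frac{15}{r}\,\varepsilon$$ for all $x\in\mathcal X$.
   Context: A map $T$ between linear spaces is additive if $T(x+y)=T(x)+T(y)$ for all $x,y$. *)

(* Defs.v *)
From mathcomp Require Export all_boot all_order all_algebra.
From mathcomp Require Export all_classical all_reals all_analysis.
Export Order.TTheory GRing.Theory Num.Theory numFieldNormedType.Exports.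

Set Implicit Arguments.
Unset Strict Implicit.
Unset Printing Implicit Defensive.

(* Main.v *)
(** Far from the origin, [f] is additive up to [3 eps / r]: compare the
  hypothesis at [(x, y)], [(x, 0)] and [(0, y)]. As [2^n u] is eventually far
  for [u <> 0], the Hyers limit [T u] of [2^-n f (2^n u)] exists everywhere, is
  additive, and is within [3 eps / r] of [f] far from the origin. The difference
  [g = f - T] satisfies the same hypothesis as [f], and its far values control
  [g x] for every [x <> 0]: if [s + t <= 4 r], write [x = (s a + t b) / r] with
  [a], [b] far; otherwise the larger of [s], [t] is at least [2 r], and one
  solves the hypothesis for the term with that coefficient, taken at [x], with
  the other argument far. *)

Require Import Defs.
From mathcomp Require Import all_boot all_order all_algebra.
From mathcomp Require Import all_classical all_reals all_analysis.
From mathcomp Require Import ring lra.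
Import Order.TTheory GRing.Theory Num.Theory numFieldNormedType.Exports.

Local Open Scope ring_scope.

(** This and the next two lemmas solve the functional inequality for one of its three terms. Which
    one applies depends on where [g x] stands. *)
Lemma norm_le_sub2l {R : realType} {Y : normedModType R} (a b c : Y) (e : R) :
  `|a - b - c| <= e -> `|a| <= e + `|b| + `|c|.
Proof.
move=> h; have -> : a = (a - b - c) + b + c by rewrite addrAC !subrK.
rewrite (le_trans (ler_normD _ _))// lerD2r (le_trans (ler_normD _ _))//.
by rewrite lerD2r.
Qed.

Lemma norm_le_sub2m {R : realType} {Y : normedModType R} (a b c : Y) (e : R) :
  `|a - b - c| <= e -> `|b| <= e + `|a| + `|c|.
Proof.
move=> h; rewrite -(normrN c); apply: norm_le_sub2l.
by rewrite distrC opprB addrC.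
Qed.

Lemma norm_le_sub2r {R : realType} {Y : normedModType R} (a b c : Y) (e : R) :
  `|a - b - c| <= e -> `|c| <= e + `|a| + `|b|.
Proof. by rewrite addrAC; apply: norm_le_sub2m. Qed.

Lemma morphD0 {U V : zmodType} (T : U -> V) :
  {morph T : x y / x + y} -> T 0 = 0.
Proof. by move=> TD; apply: (addIr (T 0)); rewrite -TD !add0r. Qed.

Lemma morphD_scale_nat {R : realType} {X Y : normedModType R} (T : X -> Y)
    (n : nat) (x : X) :
  {morph T : x y / x + y} -> T (n%:R *: x) = n%:R *: T x.
Proof.
move=> TD; rewrite !scaler_nat; elim: n => [|n IH]; first by rewrite morphD0.
by rewrite !mulrS TD IH.
Qed.

Lemma exists_natr_mul_ge {R : realType} (a b : R) : 0 < b ->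
  exists n : nat, a <= n%:R * b.
Proof.
move=> b0; exists (Num.truncn (a / b)).+1.
by rewrite -ler_pdivrMr// ltW// truncnS_gt.
Qed.

(** If [T x] were nonzero, the norm of [T (n x) = n T x] would exceed [C] for large [n]. This yields
    uniqueness. *)
Lemma bounded_morphD_eq0 {R : realType} {X Y : normedModType R} (T : X -> Y)
    (C : R) :
  {morph T : x y / x + y} -> (forall x, `|T x| <= C) -> forall x, T x = 0.
Proof.
move=> TD TC x; apply/eqP; rewrite -normr_le0 leNgt; apply/negP => Tx0.
have [n hn] := exists_natr_mul_ge (C + 1) _ Tx0.
have := TC (n%:R *: x).
by rewrite morphD_scale_nat// normrZ normr_nat; lra.
Qed.

(** * Hyers' direct method for maps that are almost additive far from 0 *)

Section HyersAtInfinity.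
Local Open Scope classical_set_scope.
Local Open Scope ring_scope.
Context {R : realType} {X : normedModType R} {Y : completeNormedModType R}.
Variables (f : X -> Y) (D C : R).
Hypothesis f0 : f 0 = 0.
Hypothesis fD : forall u v : X, D <= `|u| -> D <= `|v| ->
  `|f (u + v) - f u - f v| <= C.

Let h (u : X) (n : nat) : Y := (2^-1 ^+ n) *: f (2 ^+ n *: u).

Let pow2_gt0 n : 0 < (2 : R) ^+ n. Proof. by rewrite exprn_gt0. Qed.
Let half_gt0 n : 0 < (2^-1 : R) ^+ n.
Proof. by rewrite exprn_gt0// invr_gt0. Qed.
Let pow2_ge1 n : 1 <= (2 : R) ^+ n. Proof. by rewrite exprn_ege1// ler1n. Qed.

Let h0 : h 0 = fun=> 0.
Proof. by apply/funext => n; rewrite /h scaler0 f0 scaler0. Qed.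

Let norm_pow2 n (u : X) : `|2 ^+ n *: u| = 2 ^+ n * `|u|.
Proof. by rewrite normrZ gtr0_norm. Qed.

(** Telescoping: consecutive terms of [h u] differ by [2^-(n+1)] times the defect of [f] at
    [(2^n u, 2^n u)], and the errors [C 2^-(n+1)] form a geometric sum. *)
Lemma hyers_step (u : X) (n : nat) : D <= `|u| ->
  `|h u n - f u| <= C * (1 - 2^-1 ^+ n).
Proof.
move=> Du; elim: n => [|n IH].
  by rewrite /h !expr0 !scale1r !subrr mulr0 normr0.
have Dn : D <= `|2 ^+ n *: u|.
  by rewrite norm_pow2 (le_trans Du)// ler_peMl.
have -> : h u n.+1 - f u = 2^-1 ^+ n.+1 *: (f (2 ^+ n *: u + 2 ^+ n *: u)
    - f (2 ^+ n *: u) - f (2 ^+ n *: u)) + (h u n - f u).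
  rewrite addrA /h; congr (_ - _).
  have -> : 2 ^+ n *: u + 2 ^+ n *: u = 2 ^+ n.+1 *: u.
    by rewrite -scalerDl exprS mulr_natl mulr2n.
  rewrite -(addrA (f _)) -opprD scalerBr.
  have -> : 2^-1 ^+ n.+1 *: (f (2 ^+ n *: u) + f (2 ^+ n *: u)) =
      2^-1 ^+ n *: f (2 ^+ n *: u).
    by rewrite scalerDr -scalerDl; congr (_ *: _); rewrite exprS; field.
  by rewrite subrK.
rewrite (le_trans (ler_normD _ _))// normrZ (gtr0_norm (half_gt0 _)).
have := fD _ _ Dn Dn; have := half_gt0 n.
rewrite exprS; nra.
Qed.

(** This is [hyers_step] at the far point [2^n u], scaled back by [2^-n]; [u] itself may be near
    0. *)
Lemma hyers_cauchy (u : X) (n k : nat) : D <= 2 ^+ n * `|u| ->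
  `|h u n - h u (n + k)| <= 2^-1 ^+ n * C.
Proof.
move=> Dn.
have Du : D <= `|2 ^+ n *: u| by rewrite norm_pow2.
have -> : h u n - h u (n + k) =
    - (2^-1 ^+ n *: (h (2 ^+ n *: u) k - f (2 ^+ n *: u))).
  by rewrite -[RHS]scalerN opprB scalerBr /h !scalerA -!exprD addnC.
rewrite normrN normrZ (gtr0_norm (half_gt0 _)) ler_pM2l//.
have := hyers_step _ k Du; have := half_gt0 k.
(* [0 <= C], because [C] bounds a norm at a far pair. *)
have := le_trans (normr_ge0 _) (fD _ _ Du Du).
nra.
Qed.

Let half_cvg0 : (fun n => 2^-1 ^+ n * C) @ \oo --> (0 : R).
Proof.
rewrite -(mul0r C); apply: cvgM; last exact: cvg_cst.
by apply: cvg_expr; rewrite gtr0_norm ?invr_gt0// invf_lt1// ltr1n.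
Qed.

Lemma pow2_near (u : X) : u != 0 -> \forall n \near \oo, D <= 2 ^+ n * `|u|.
Proof.
rewrite -normr_gt0 => u0; have [N hN] := exists_natr_mul_ge D _ u0.
exists N => // n /= Nn; rewrite (le_trans hN)// ler_pM2r//.
by rewrite -natrX ler_nat (leq_trans Nn)// ltnW// ltn_expl.
Qed.

Lemma hyers_cvg (u : X) : cvgn (h u).
Proof.
have [->|u0] := eqVneq u 0.
  by rewrite h0; exact: is_cvg_cst.
apply/cauchy_cvgP/cauchy_exP => e e0.
have : \forall n \near \oo, D <= 2 ^+ n * `|u| /\ `|0 - 2^-1 ^+ n * C| < e.
  apply: filterI; first exact: pow2_near.
  exact: (proj1 (cvgrPdist_lt _ _) half_cvg0).
move=> [n _ /(_ n (leqnn n))[Dn en]]; exists (h u n).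
exists n => // m /= nm; rewrite -ball_normE /= -(subnKC nm).
rewrite (le_lt_trans (hyers_cauchy _ _ _ Dn))// (le_lt_trans (ler_norm _))//.
by rewrite sub0r normrN in en.
Qed.

Lemma hyers_at_infinity : exists T : X -> Y,
  {morph T : x y / x + y} /\ forall u, D <= `|u| -> `|f u - T u| <= C.
Proof.
exists (fun u => lim (h u @ \oo)); split; last first.
  move=> u Du; rewrite distrC.
  have hl : (fun n => `|h u n - f u|) @ \oo --> `|lim (h u @ \oo) - f u|.
    by apply: cvg_norm; apply: cvgB (hyers_cvg u) (cvg_cst _).
  apply: (cvgr_to_le hl); near=> n.
  rewrite (le_trans (hyers_step _ n Du))//.
  have := half_gt0 n; have := le_trans (normr_ge0 _) (fD _ _ Du Du).
  nra.
have lim0 : lim (h 0 @ \oo) = 0.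
  by rewrite h0; exact: lim_cst.
move=> u v.
(* Zero arguments are treated apart, as doubling need not take them far. For nonzero [u] and [v] the
   scaled defect is eventually at most [2^-n C], which tends to 0. *)
have [->|u0] := eqVneq u 0; first by rewrite lim0 !add0r.
have [->|v0] := eqVneq v 0; first by rewrite lim0 !addr0.
apply/eqP; rewrite -subr_eq0 opprD addrA -normr_le0.
have hl : (fun n => `|h (u + v) n - h u n - h v n|) @ \oo -->
    `|lim (h (u + v) @ \oo) - lim (h u @ \oo) - lim (h v @ \oo)|.
  apply: cvg_norm; apply: cvgB (hyers_cvg v).
  by apply: cvgB (hyers_cvg u); exact: hyers_cvg.
apply: (ler_cvg_to hl half_cvg0); near=> n.
rewrite /h -!scalerBr normrZ (gtr0_norm (half_gt0 _)) ler_pM2l// scalerDr.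
by apply: fD; rewrite norm_pow2; near: n; exact: pow2_near.
Unshelve. all: by end_near. Qed.

End HyersAtInfinity.

(** * Consequences of the functional inequality, near and far from 0 *)

Section JensenDefect.
Context {R : realType} {X Y : normedModType R}.
Variables (g : X -> Y) (r s t d eps : R).
Hypotheses (r_ge1 : 1 <= r) (s_ge1 : 1 <= s) (t_ge1 : 1 <= t).
Hypotheses (d_gt0 : 0 < d) (eps_gt0 : 0 < eps).
Hypothesis g0 : g 0 = 0.
Hypothesis hg : forall x y : X, d <= `|x| + `|y| ->
  `|r *: g (r^-1 *: (s *: x + t *: y)) - s *: g x - t *: g y| <= eps.

Let r_gt0 : 0 < r. Proof. exact: lt_le_trans ltr01 r_ge1. Qed.
Let s_gt0 : 0 < s. Proof. exact: lt_le_trans ltr01 s_ge1. Qed.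
Let t_gt0 : 0 < t. Proof. exact: lt_le_trans ltr01 t_ge1. Qed.

Lemma defect_additive_far (u v : X) :
  d * (s + t) / r <= `|u| -> d * (s + t) / r <= `|v| ->
  `|g (u + v) - g u - g v| <= 3 / r * eps.
Proof.
move=> Du Dv.
(* Using [s + t] in the threshold makes it serve both coefficients: it suffices that each is at most
   [s + t]. *)
have far (a : R) (w : X) : 0 < a -> a <= s + t -> d * (s + t) / r <= `|w| ->
    d <= `|(r / a) *: w|.
  move=> a0 ast Dw; rewrite normrZ gtr0_norm ?divr_gt0// mulrAC ler_pdivlMr//.
  rewrite ler_pdivrMr// in Dw.
  by rewrite (mulrC r) (le_trans _ Dw)// ler_pM2l.
have du : d <= `|(r / s) *: u| by apply: far => //; rewrite lerDl ltW.
have dv : d <= `|(r / t) *: v| by apply: far => //; rewrite lerDr ltW.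
have back (a : R) (w : X) : 0 < a -> r^-1 *: (a *: ((r / a) *: w)) = w.
  move=> a0; rewrite !scalerA (_ : _ * _ = 1) ?scale1r//.
  by field; rewrite !gt_eqF.
have huv : d <= `|(r / s) *: u| + `|(r / t) *: v|.
  by rewrite (le_trans du)// lerDl.
have hu0 : d <= `|(r / s) *: u| + `|0 : X| by rewrite normr0 addr0.
have h0v : d <= `|0 : X| + `|(r / t) *: v| by rewrite normr0 add0r.
have := hg _ _ huv; have := hg _ _ hu0; have := hg _ _ h0v.
rewrite g0 !scaler0 subr0 addr0 add0r scalerDr !back// subr0.
set A := s *: g _; set B := t *: g _ => hB hA hAB.
rewrite -(ler_pM2l r_gt0) -[X in X * `|_|](gtr0_norm r_gt0) -normrZ.
(* The unknown terms [A] and [B] cancel, leaving three errors of size [eps]. *)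
have -> : r *: (g (u + v) - g u - g v) =
    (r *: g (u + v) - A - B) - (r *: g u - A) - (r *: g v - B).
  by rewrite !scalerBr !opprB (addrAC _ (- A)) subrKA (addrAC _ (- B)) subrKA.
have -> : r * (3 / r * eps) = eps + eps + eps by field; rewrite gt_eqF.
by do 2 rewrite (le_trans (ler_normB _ _))// lerD//.
Qed.

Lemma defect_bound (D : R) (x : X) : 0 <= D ->
  (forall u, D <= `|u| -> `|g u| <= 3 / r * eps) ->
  `|g x| <= 15 / r * eps.
Proof.
move=> D0 gfar.
have [r0 s0 t0] : [/\ 0 <= r, 0 <= s & 0 <= t] by rewrite !ltW.
have [->|x0] := eqVneq x 0.
  by rewrite g0 normr0 mulr_ge0// ?ltW// divr_gt0.
have c0 : 0 < r * (s + t) by rewrite mulr_gt0// addr_gt0.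
rewrite -normr_gt0 in x0.
(* One [N] serves every case below: [c x] is far as soon as [c r (s + t) >= N]. Far means norm at
   least [D + d], so that both [gfar] and [hg] apply. *)
have [n hn] := exists_natr_mul_ge ((D + d) * (r * (s + t))) _ x0.
set N : R := n%:R in hn; have N0 : 0 <= N by [].
have far (c : R) : N <= c * (r * (s + t)) -> D + d <= `|c *: x|.
  move=> hc; rewrite normrZ -(ler_pM2r c0) (le_trans hn)//.
  by rewrite mulrAC ler_pM2r// (le_trans hc)// ler_pM2r// ler_norm.
have gfar' w : D + d <= `|w| -> d <= `|w| /\ r * `|g w| <= 3 * eps.
  move=> hw; split; first by rewrite (le_trans _ hw)// lerDr.
  have -> : 3 * eps = r * (3 / r * eps) by field; rewrite gt_eqF.
  by rewrite ler_pM2l// gfar// (le_trans _ hw)// lerDl ltW.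
have -> : 15 / r * eps = r^-1 * (15 * eps) by field; rewrite gt_eqF.
rewrite ler_pdivlMl//.
have nx (a : R) (w : X) : 0 < a -> `|a *: g w| = a * `|g w|.
  by move=> a0; rewrite normrZ gtr0_norm.
(* Here [a = r (N + 1) / s x] and [b = - r N / t x], so [(s a + t b) / r = (N + 1) x - N x = x]. The
   resulting bound for [r |g x|] is [eps + 3 eps (s + t) / r <= 13 eps]. *)
have [st4|st4] := leP (s + t) (4 * r).
  have [] := gfar' ((r * (N + 1) / s) *: x).
    apply: far; have -> : r * (N + 1) / s * (r * (s + t)) =
        N + (N * (r ^+ 2 - 1) + r ^+ 2 + (N + 1) * r ^+ 2 * t / s).
      by field; rewrite gt_eqF.
    rewrite lerDl !addr_ge0// ?mulr_ge0// ?invr_ge0 ?subr_ge0 ?exprn_ege1//;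
      by rewrite ?addr_ge0// ?exprn_ge0.
  set a := _ *: x => da ga.
  have [] := gfar' ((- (r * N / t)) *: x).
    rewrite scaleNr normrN.
    apply: far; have -> : r * N / t * (r * (s + t)) =
        N + (N * (r ^+ 2 - 1) + N * r ^+ 2 * s / t).
      by field; rewrite gt_eqF.
    rewrite lerDl !addr_ge0// ?mulr_ge0// ?invr_ge0 ?subr_ge0 ?exprn_ege1//;
      by rewrite ?addr_ge0// ?exprn_ge0.
  set b := _ *: x => db gb.
  have := hg a b; rewrite (le_trans da) ?lerDl// => /(_ isT).
  have -> : r^-1 *: (s *: a + t *: b) = x.
    rewrite /a /b !scalerA -scalerDl scalerA -[RHS]scale1r; congr (_ *: _).
    by field; rewrite !gt_eqF.
  move/norm_le_sub2l; rewrite !nx// => h.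
  set A := `|g a| in ga h *; set B := `|g b| in gb h *; set G := `|g x| in h *.
  have hs : s * (r * A) <= s * (3 * eps) by rewrite ler_pM2l.
  have ht : t * (r * B) <= t * (3 * eps) by rewrite ler_pM2l.
  have hst : (s + t) * (3 * eps) <= 4 * r * (3 * eps).
    by rewrite ler_pM2r// mulr_gt0.
  have hAB : s * A + t * B <= 12 * eps by rewrite -(ler_pM2l r_gt0); lra.
  move: eps_gt0; lra.
(* Now [a] is the larger of [s] and [t]. Dividing by [a] bounds [r |g x|] by
   [4 eps r / a + 3 eps b / a <= 5 eps]. *)
have key (a b : R) (y z : X) : 0 < a -> 0 < b -> 2 * r <= a -> b <= a ->
    `|a *: g x| <= eps + `|r *: g z| + `|b *: g y| ->
    r * `|g z| <= 3 * eps -> r * `|g y| <= 3 * eps -> r * `|g x| <= 15 * eps.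
  move=> a0 b0 ra ba; rewrite !nx// => h hz hy.
  have h1 : r * (a * `|g x|) <= r * (eps + r * `|g z| + b * `|g y|).
    by rewrite ler_pM2l.
  have h2 : b * (r * `|g y|) <= b * (3 * eps) by rewrite ler_pM2l.
  have h3 : r * (r * `|g z|) <= r * (3 * eps) by rewrite ler_pM2l.
  have h4 : 2 * r * eps <= a * eps by rewrite ler_pM2r.
  have h5 : b * eps <= a * eps by rewrite ler_pM2r.
  have h6 : 0 <= a * eps by rewrite mulr_ge0// ltW.
  by rewrite -(ler_pM2l a0); lra.
have farN : D + d <= `|N *: x|.
  by apply: far; rewrite ler_peMr//; move: r_ge1 s_ge1 t_ge1; nra.
have [dN gN] := gfar' _ farN.
(* With [y = N x] far, the combined argument [z] is far too, since both coefficients of [x] are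
   nonnegative and no cancellation occurs. Stated for [a], [b] to cover both orders of [s] and
   [t]. *)
have far_add (a b : R) : 1 <= a -> 1 <= b -> a + b = s + t ->
    D + d <= `|r^-1 *: (a *: x + b *: (N *: x))|.
  move=> a1 b1 ab; rewrite scalerA -scalerDl scalerA; apply: far.
  have -> : r^-1 * (a + b * N) * (r * (s + t)) = (a + b * N) * (a + b).
    by rewrite ab; field; rewrite gt_eqF.
  have bN : N <= b * N by rewrite ler_peMl.
  have aN : N <= a + b * N by lra.
  by rewrite (le_trans aN)// ler_peMr; lra.
have [ts|st] := leP t s.
  have [_ gz] := gfar' _ (far_add s t s_ge1 t_ge1 erefl).
  apply: (key _ _ _ _ s_gt0 t_gt0 _ ts _ gz gN); first by lra.
  by apply: norm_le_sub2m; apply: hg; rewrite (le_trans dN)// lerDr.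
have [_ gz] := gfar' _ (far_add t s t_ge1 s_ge1 (addrC _ _)).
apply: (key _ _ _ _ t_gt0 s_gt0 _ (ltW st) _ gz gN); first by lra.
apply: norm_le_sub2r; rewrite (addrC (t *: x)); apply: hg.
by rewrite (le_trans dN)// lerDl.
Qed.

End JensenDefect.

Theorem theorem3p1 (R : realType) (X : normedModType R)
    (Y : completeNormedModType R) (r s t : nat)
    (r_gt0 : (0 < r)%N) (s_gt0 : (0 < s)%N) (t_gt0 : (0 < t)%N)
    (d eps : R) (d_gt0 : 0 < d) (eps_gt0 : 0 < eps)
    (f : X -> Y) (f0 : f 0 = 0)
    (hf : forall x y : X, d <= `|x| + `|y| ->
      `|r%:R *: f (r%:R^-1 *: (s%:R *: x + t%:R *: y))
        - s%:R *: f x - t%:R *: f y| <= eps) :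
  exists! T : X -> Y,
    {morph T : x y / x + y} /\
    (forall x : X, `|f x - T x| <= 15%:R / r%:R * eps).
Proof.
have [r1 s1 t1] : [/\ 1 <= r%:R :> R, 1 <= s%:R :> R & 1 <= t%:R :> R].
  by rewrite !ler1n.
have [T [TD Tf]] := hyers_at_infinity f _ _ f0
  (defect_additive_far f _ _ _ _ _ r1 s1 t1 d_gt0 f0 hf).
have T15 x : `|f x - T x| <= 15 / r%:R * eps.
  apply: (defect_bound (fun x => f x - T x) _ _ _ _ _ r1 s1 t1 d_gt0 eps_gt0
    _ _ _ x _ Tf) => [|u v huv|] /=.
  - by rewrite f0 (morphD0 _ TD) subr0.
  (* Additivity gives homogeneity for natural scalars, so the factor [r] is moved inside [T] to
     cancel its inverse. Hence [T] solves the equation exactly and [f - T] inherits the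
     inequality. *)
  - have Tz : r%:R *: T (r%:R^-1 *: (s%:R *: u + t%:R *: v)) =
        s%:R *: T u + t%:R *: T v.
      rewrite -(morphD_scale_nat _ r _ TD) scalerA.
      rewrite divff ?pnatr_eq0 -?lt0n// scale1r.
      by rewrite TD !(morphD_scale_nat _ _ _ TD).
    rewrite !scalerBr Tz !opprB opprD (addrA (r%:R *: f _)).
    rewrite (addrAC _ (- (s%:R *: T u))) subrKA (addrAC _ (- (t%:R *: T v))).
    by rewrite subrKA; exact: hf.
  - by rewrite divr_ge0// mulr_ge0 ?addr_ge0// ltW.
exists T; split=> // T' [T'D T'f].
(* Uniqueness: [T - T'] is additive and bounded by twice the allowed error, hence zero. *)
apply/funext => x; apply/eqP; rewrite -subr_eq0; apply/eqP.
apply: (bounded_morphD_eq0 (fun z => T z - T' z)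
  (15 / r%:R * eps + 15 / r%:R * eps)) => [u v|z] /=.
  by rewrite TD T'D opprD addrACA.
rewrite -(subrKA (f z)) (le_trans (ler_normD _ _))// lerD//.
by rewrite distrC.
Qed.
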